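(* Suppose there exists a Kirkman frame on $v$ points of type $T$. Suppose that for some positive integer $w$, for each $t \in T$ there exists a Kirkman triple system of order $3t+w$ with a rainbow colouring $\phi$ that contains a rainbow subsystem on $w$ points (with respect to $\phi$). Then there exists a rainbow Kirkman triple system of order $3v+w$.
   Context: A $3$-GDD is a triple $(V,\mathcal{G},\mathcal{B})$ where $\mathcal{G}$ is a partition of $V$ into groups and $\mathcal{B}$ is a set of $3$-subsets (blocks) such that every pair of points in different groups lies in exactly one block and no block meets a group in more than one point. Its type is the multiset $T=\{|G| : G\in\mathcal{G}\}$. A Kirkman frame is a $3$-GDD together with a partition of $\mathcal{B}$ into partial parallel classes, each of which is a partition of $V\setminus G$ for some group $G$. A Kirkman triple system KTS$(n)$ is a Steiner triple system on $n$ points together with a partition of its triples into parallel classes (partitions of the point set). A $3$-colouring maps points to $3$ colours with no monochromatic triple. A colouring of a KTS$(n)$ is rainbow if it is a $3$-colouring with each colour class of size $n/3$ and some parallel class in which every triple receives all three colours; a KTS is rainbow if it admits a rainbow colouring. A subsystem of a KTS $(V,\mathcal{B})$ with resolution $\mathcal{R}$ is a KTS $(V',\mathcal{B}')$ with resolution $\mathcal{R}'$ such that $V'\subseteq V$, $\mathcal{B}'\subseteq\mathcal{B}$ and each class of $\mathcal{R}'$ is a subset of some class of $\mathcal{R}$. A rainbow subsystem with respect to a rainbow colouring $\phi$ is a subsystem which is rainbow under the restriction of $\phi$. *)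

(* Defs.v *)
From mathcomp Require Import all_boot.

Set Implicit Arguments.
Unset Strict Implicit.
Unset Printing Implicit Defensive.

(* Point sets are subsets X of an ambient finite type P, so that a system and
   its subsystems live over the same P, and restricting a colouring
   [phi : P -> 'I_3] to a subsystem just means evaluating the same predicate on
   the smaller point set.  MathComp's [partition] has no empty parts. *)

Definition triples_on (P : finType) (X : {set P}) (B : {set {set P}}) : Prop :=
  forall b, b \in B -> b \subset X /\ #|b| = 3.

Definition in_unique_block (P : finType) (B : {set {set P}}) (x y : P) : Prop :=
  exists! b : {set P}, b \in B /\ (x \in b /\ y \in b).

Definition GDD3 (P : finType) (X : {set P}) (G B : {set {set P}}) : Prop :=
  [/\ partition G X,
      triples_on X B,
      forall g h x y, g \in G -> h \in G -> g != h -> x \in g -> y \in h ->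
        in_unique_block B x y
    & forall b g, b \in B -> g \in G -> #|b :&: g| <= 1].

Definition group_type (P : finType) (G : {set {set P}}) : seq nat :=
  [seq #|g| | g : {set P} <- enum G].

Definition kirkman_frame (P : finType) (X : {set P}) (G B : {set {set P}})
    (R : {set {set {set P}}}) : Prop :=
  [/\ GDD3 X G B,
      partition R B
    & forall C, C \in R -> exists2 g, g \in G & partition C (X :\: g)].

Definition steiner_triple_system (P : finType) (X : {set P})
    (B : {set {set P}}) : Prop :=
  triples_on X B /\
  forall x y, x \in X -> y \in X -> x != y -> in_unique_block B x y.

Definition kirkman_triple_system (P : finType) (X : {set P})
    (B : {set {set P}}) (R : {set {set {set P}}}) : Prop :=
  [/\ steiner_triple_system X B,
      partition R B
    & forall C, C \in R -> partition C X].

Definition three_colouring (P : finType) (B : {set {set P}})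
    (phi : P -> 'I_3) : Prop :=
  forall b, b \in B -> ~ exists c, forall x, x \in b -> phi x = c.

Definition rainbow_triple (P : finType) (phi : P -> 'I_3) (b : {set P}) : Prop :=
  forall c, exists2 x, x \in b & phi x = c.

(* The factor 3 on the left makes "size n/3" exact (no truncated division). *)
Definition rainbow_colouring (P : finType) (X : {set P}) (B : {set {set P}})
    (R : {set {set {set P}}}) (phi : P -> 'I_3) : Prop :=
  [/\ three_colouring B phi,
      forall c, 3 * #|[set x in X | phi x == c]| = #|X|
    & exists2 C, C \in R & forall b, b \in C -> rainbow_triple phi b].

Definition KTS_subsystem (P : finType)
    (X' : {set P}) (B' : {set {set P}}) (R' : {set {set {set P}}})
    (X : {set P}) (B : {set {set P}}) (R : {set {set {set P}}}) : Prop :=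
  [/\ kirkman_triple_system X' B' R',
      X' \subset X,
      B' \subset B
    & forall C', C' \in R' -> exists2 C, C \in R & C' \subset C].

Definition has_rainbow_subsystem (P : finType) (X : {set P})
    (B : {set {set P}}) (R : {set {set {set P}}}) (phi : P -> 'I_3)
    (w : nat) : Prop :=
  exists X' B' R',
    [/\ KTS_subsystem X' B' R' X B R, #|X'| = w
      & rainbow_colouring X' B' R' phi].

(* Main.v *)
Require Import Defs.
From mathcomp Require Import all_boot zify.

Set Implicit Arguments.
Unset Strict Implicit.
Unset Printing Implicit Defensive.

(* Give every frame point weight 3 and adjoin a set W of w points, colouring
   (x, i) by i.  A frame block b is replaced by the nine triples having level i
   at two points of b and level i + 1 at the third one, z; none of them is
   monochromatic, and fixing z gives a parallel class of b x Z_3.  Each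
   (group x Z_3) + W is filled with the given system by a colour-preserving
   bijection, its subsystem being replaced by a single one on W.

   The rainbow class of the result is the union of a rainbow class of W and of
   the remainders of the rainbow classes of the fillings.  This needs the
   rainbow class of each filling to contain a class of its subsystem, which is
   not part of the hypotheses but follows by counting: a non-rainbow triple
   contains exactly twice as many bichromatic as monochromatic pairs, so that a
   balanced 3-colouring of n points has exactly n/3 rainbow triples, and the
   rainbow class consists of all of them. *)

(** * Partitions and colour-preserving bijections *)

Lemma partition_intro (P : finType) (X : {set P}) (D : {set {set P}}) :
  (forall b, b \in D -> b != set0 /\ b \subset X) ->
  (forall x, x \in X -> exists2 b, b \in D & x \in b) ->
  (forall b b' x, b \in D -> b' \in D -> x \in b -> x \in b' -> b = b') ->
  partition D X.
Proof.
move=> sub cov uniq; apply/and3P; split.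
- apply/eqP/setP => x; apply/bigcupP/idP => [[b bD xb]|/cov[b bD xb]].
    by have [_ /subsetP] := sub _ bD; apply.
  by exists b.
- apply/trivIsetP => b b' bD b'D; apply: contraR => /pred0Pn[x /andP[xb xb']].
  by apply/eqP; apply: (uniq _ _ x).
- by apply/negP => /sub[]; rewrite eqxx.
Qed.

Lemma partition_ex (P : finType) (X : {set P}) (D : {set {set P}}) x :
  partition D X -> x \in X -> exists2 b, b \in D & x \in b.
Proof. by move=> DX; rewrite -(cover_partition DX) => /bigcupP[b]; exists b. Qed.

Lemma partition_uniq (P : finType) (X : {set P}) (D : {set {set P}}) x b b' :
  partition D X -> b \in D -> b' \in D -> x \in b -> x \in b' -> b = b'.
Proof.
move=> /partition_trivIset tD bD b'D xb xb'.
by rewrite -(def_pblock tD bD xb) (def_pblock tD b'D xb').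
Qed.

Lemma partition_sub (P : finType) (X : {set P}) (D : {set {set P}}) x b :
  partition D X -> b \in D -> x \in b -> x \in X.
Proof. by move=> DX bD; apply: (subsetP (partitionS DX bD)). Qed.

(** Fibres of equal size are matched by position in their enumerations; [y0] is only a default for
    [nth]. A constant colouring yields a plain bijection, and a two-valued one can force a marked
    element onto another. *)
Lemma colour_matching (S T : finType) (K : eqType) (col : S -> K)
    (col' : T -> K) (A : {set S}) (A' : {set T}) (y0 : T) :
  (forall c, #|[set x in A | col x == c]| = #|[set y in A' | col' y == c]|) ->
  exists f : S -> T, [/\ {in A &, injective f}, f @: A = A'
    & {in A, forall x, col' (f x) = col x}].
Proof.
move=> eq_card.
pose src c := enum [set x in A | col x == c].
pose tgt c := enum [set y in A' | col' y == c].
have size_eq c : size (src c) = size (tgt c) by rewrite /src /tgt -!cardE.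
pose f x := nth y0 (tgt (col x)) (index x (src (col x))).
have mem_src x c : (x \in src c) = (x \in A) && (col x == c).
  by rewrite mem_enum inE.
have mem_tgt y c : (y \in tgt c) = (y \in A') && (col' y == c).
  by rewrite mem_enum inE.
have fP x : x \in A -> f x \in tgt (col x).
  by move=> xA; rewrite mem_nth // -size_eq index_mem mem_src xA eqxx.
have fcol x : x \in A -> col' (f x) = col x.
  by move/fP; rewrite mem_tgt => /andP[_ /eqP].
exists f; split => // [x x' xA x'A eqf|].
  have eqc : col x = col x' by rewrite -!fcol // eqf.
  have := eqf; rewrite /f -eqc => /eqP.
  have inx : x \in src (col x) by rewrite mem_src xA eqxx.
  have inx' : x' \in src (col x) by rewrite mem_src x'A eqc eqxx.
  rewrite nth_uniq ?enum_uniq -?size_eq ?index_mem // => /eqP eqi.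
  by rewrite -(nth_index x inx) eqi nth_index.
apply/setP => y; apply/imsetP/idP => [[x xA ->]|yA].
  by have := fP _ xA; rewrite mem_tgt => /andP[].
have iny : y \in tgt (col' y) by rewrite mem_tgt yA eqxx.
have lti : index y (tgt (col' y)) < size (src (col' y)).
  by rewrite size_eq index_mem.
case Es: (src (col' y)) => [|x0 s]; first by rewrite Es in lti.
pose x := nth x0 (src (col' y)) (index y (tgt (col' y))).
have : x \in src (col' y) by rewrite mem_nth.
rewrite mem_src => /andP[xA /eqP cx]; exists x => //.
by rewrite /f cx index_uniq ?enum_uniq // nth_index.
Qed.

(** * Counting the classes of Kirkman systems and frames *)

(** The blocks through [x], with [x] removed, split [S] into pairs, and each class covering [x]
    holds exactly one of these blocks. [S] is the set of points joined to [x]: all other points in a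
    triple system, the complement of a group in a frame. *)
Lemma card_classes_through (P : finType) (S : {set P}) (B : {set {set P}})
    (R : {set {set {set P}}}) x :
  partition R B -> (forall C, C \in R -> trivIset C) ->
  (forall b, b \in B -> #|b| = 3) -> x \notin S ->
  (forall y, y \in S -> in_unique_block B x y) ->
  (forall b, b \in B -> x \in b -> b :\ x \subset S) ->
  #|S| = 2 * #|[set C in R | x \in cover C]|.
Proof.
move=> RB tR b3 xS uS subS.
have Dpart : partition [set b :\ x | b in [set b in B | x \in b]] S.
  apply: partition_intro => [c /imsetP[b]|y yS|c c' y].
  - rewrite inE => /andP[bB xb] ->; split; last exact: subS.
    by rewrite -card_gt0; have := cardsD1 x b; rewrite xb b3 //; lia.
  - have [b [[bB [xb yb]] _]] := uS _ yS; exists (b :\ x).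
      by apply/imsetP; exists b; rewrite ?inE ?bB.
    by rewrite !inE yb andbT; apply: contraNneq xS => <-.
  - case/imsetP=> b; rewrite inE => /andP[bB xb] ->.
    case/imsetP=> b'; rewrite inE => /andP[bB' xb'] ->.
    rewrite !inE => /andP[yx yb] /andP[_ yb'].
    have yS : y \in S by apply: (subsetP (subS _ bB xb)); rewrite !inE yx.
    have [d [_ ud]] := uS _ yS.
    by rewrite -(ud b) // (ud b').
rewrite (card_uniform_partition (n := 2) _ Dpart); last first.
  move=> c /imsetP[b]; rewrite inE => /andP[bB xb] ->.
  by have := cardsD1 x b; rewrite xb b3 //; lia.
rewrite mulnC; congr (_ * _).
rewrite card_in_imset; last first.
  move=> b b'; rewrite !inE => /andP[_ xb] /andP[_ xb'] E.
  by rewrite -(setD1K xb) E setD1K.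
(* A block through [x] is recovered from its class as the part containing [x]. *)
have -> : [set b in B | x \in b] =
          [set pblock C x | C in [set C in R | x \in cover C]].
  apply/setP => b; rewrite inE; apply/andP/imsetP => [[bB xb]|[C]].
    have [C CR bC] := partition_ex RB bB.
    exists C; last by rewrite (def_pblock (tR _ CR) bC xb).
    by rewrite inE CR; apply/bigcupP; exists b.
  rewrite inE => /andP[CR xC] ->; rewrite mem_pblock xC; split=> //.
  by apply: (partition_sub RB CR); apply: pblock_mem.
rewrite card_in_imset // => C C'; rewrite !inE => /andP[CR xC] /andP[CR' xC'] E.
apply: (partition_uniq RB CR CR' (pblock_mem xC)).
by rewrite E pblock_mem.
Qed.

Lemma card_KTS_classes (P : finType) (X : {set P}) (B : {set {set P}})
    (R : {set {set {set P}}}) :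
  kirkman_triple_system X B R -> 0 < #|X| -> #|X| = (2 * #|R|).+1.
Proof.
move=> [[tB uB] RB RX] /card_gt0P[x xX].
rewrite (cardsD1 x) xX add1n; congr _.+1.
rewrite (card_classes_through (x := x) RB).
- congr (2 * #|pred_of_set _|); apply/setP => C; rewrite inE.
  by case CR: (C \in R) => //=; rewrite (cover_partition (RX _ CR)).
- by move=> C /RX /partition_trivIset.
- by move=> b /tB[].
- by rewrite !inE eqxx.
- by move=> y; rewrite !inE => /andP[yx yX]; apply: uB => //; rewrite eq_sym.
- by move=> b bB xb; apply: setSD; have [] := tB _ bB.
Qed.

(** A point of [g] is covered by all classes except the [r g] ones missing [g], whence |V| - |g| =
    2(|R| - r g). Summing over the groups gives (|G| - 1)(2|R| - |V|) = 0, and the first factor is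
    positive. *)
Lemma card_frame_classes (V : finType) (G B : {set {set V}})
    (R : {set {set {set V}}}) :
  kirkman_frame [set: V] G B R -> 1 < #|G| ->
  2 * #|R| = #|V| /\
  {in G, forall g, 2 * #|[set C in R | partition C (~: g)]| = #|g|}.
Proof.
move=> [[GV tB uB gB] RB RG] G1.
pose r g := #|[set C in R | partition C (~: g)]|.
have RGs C : C \in R -> exists2 g, g \in G & partition C (~: g).
  by move=> /RG[g gG]; rewrite setTD => ?; exists g.
have coverE (C : {set {set V}}) g : partition C (~: g) -> cover C = ~: g.
  exact: cover_partition.
have holeE (C : {set {set V}}) g g' : partition C (~: g) -> partition C (~: g') -> g = g'.
  by move=> /coverE E /coverE E'; apply: setC_inj; rewrite -E -E'.
have local g : g \in G -> 2 * #|R| + #|g| = #|V| + 2 * r g.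
  move=> gG; have /set0Pn[x xg] := partition_neq0 GV gG.
  have := card_classes_through (x := x) (S := ~: g) RB.
  have -> : [set C in R | x \in cover C] =
            R :\: [set C in R | partition C (~: g)].
    apply/setP => C; rewrite !inE; case CR: (C \in R); rewrite /= ?andbF //.
    rewrite andbT; have [h hG Ch] := RGs _ CR.
    rewrite (coverE _ _ Ch) inE; congr (~~ _).
    apply/idP/idP => [xh|Cg]; last by rewrite (holeE _ _ _ Ch Cg).
    by rewrite (partition_uniq GV gG hG xg xh).
  have := cardsID [set C in R | partition C (~: g)] R.
  have -> : R :&: [set C in R | partition C (~: g)] =
            [set C in R | partition C (~: g)].
    by apply/setP => C; rewrite !inE; case: (C \in R).
  rewrite -/(r g) => <- cnt.
  have := cardsC g; rewrite cnt; first by rewrite mulnDr; lia.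
  - by move=> C /RGs[h _ /partition_trivIset].
  - by move=> b /tB[].
  - by rewrite inE xg.
  - move=> y; rewrite inE => yg; have [h hG yh] := partition_ex GV (in_setT y).
    by apply: (uB g h) => //; apply: contraNneq yg => ->.
  - move=> b bB xb; apply/subsetP => y; rewrite !inE => /andP[yx yb].
    apply/negP => yg; have := gB _ _ bB gG; rewrite leqNgt; case/negP.
    by apply/card_gt1P; exists x, y; rewrite !inE xb xg yb yg eq_sym.
(* Double counting: each class misses exactly one group. *)
have sumr : \sum_(g in G) r g = #|R|.
  have -> : #|R| = \sum_(C in R) \sum_(g in G | partition C (~: g)) 1.
    rewrite -sum1_card; apply: eq_bigr => C CR.
    have [g gG Cg] := RGs _ CR.
    rewrite (big_pred1 g) // => h /=; apply/andP/eqP => [[_ Ch]|->] //.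
    exact: (holeE _ _ _ Ch Cg).
  rewrite (exchange_big_dep (mem G)) /=; last by move=> ? ? _ /andP[].
  apply: eq_bigr => g gG; rewrite /r -sum1_card; apply: eq_bigl => C.
  by rewrite inE gG.
have sumg : \sum_(g in G) #|g| = #|V| by rewrite -cardsT (card_partition GV).
have total : \sum_(g in G) (2 * #|R| + #|g|) = \sum_(g in G) (#|V| + 2 * r g).
  by apply: eq_bigr.
rewrite !big_split /= sumg sumr !sum_nat_const !muln0 in total.
have RV : 2 * #|R| = #|V|.
  move: total G1; case: #|G| => [|[|u]] // + _.
  move: #|R| #|V| => a b; nia.
by split => // g /local; rewrite -/(r g); lia.
Qed.

(** * Recognising a Kirkman triple system by counting *)

(** With the right number of classes, uniqueness of the block through two points and disjointness of
    the classes follow from covering, so a construction only has to exhibit one block for each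
    pair. *)
Lemma KTS_of_classes (P K : finType) (A : {set K})
    (cls : K -> {set {set P}}) :
  0 < #|P| -> #|P| = (2 * #|A|).+1 ->
  (forall k, k \in A -> partition (cls k) [set: P]) ->
  (forall k b, k \in A -> b \in cls k -> #|b| = 3) ->
  (forall x y, x != y -> exists k b,
     [/\ k \in A, b \in cls k, x \in b & y \in b]) ->
  kirkman_triple_system [set: P] (\bigcup_(k in A) cls k) (cls @: A).
Proof.
move=> P0 PA part b3 cov.
have pblE k b x : k \in A -> b \in cls k -> x \in b -> pblock (cls k) x = b.
  move=> kA bk xb; apply: def_pblock xb => //.
  exact: partition_trivIset (part _ kA).
have in_cover k x : k \in A -> x \in cover (cls k).
  by move=> kA; rewrite (cover_partition (part _ kA)) inE.
(* Every point meets 2|A| = |P| - 1 others, with multiplicity, so "at least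
   once" becomes "exactly once". *)
have mult1 x y : x != y -> #|[set k in A | y \in pblock (cls k) x]| = 1.
  move=> xy; pose c z := #|[set k in A | z \in pblock (cls k) x]|.
  have c1 z : z != x -> 1 <= c z ?= iff (c z == 1).
    move=> zx; split; last by rewrite eq_sym.
    rewrite card_gt0; apply/set0Pn.
    have [k [b [kA bk xb zb]]] : exists k b,
       [/\ k \in A, b \in cls k, x \in b & z \in b] by apply: cov; rewrite eq_sym.
    by exists k; rewrite inE kA (pblE k b).
  have [_ /esym] := leqif_sum c1.
  (* Each class contributes the two other points of its block through [x], so the multiplicities add
     up to 2|A|, the number of points other than [x]. *)
  have -> : \sum_(z | z != x) 1 = \sum_(z | z != x) c z.
    have -> : \sum_(z | z != x) 1 = 2 * #|A|.
      rewrite sum1_card; have := cardC1 x; rewrite PA /= => <-.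
      by apply: eq_card => z; rewrite !inE.
    under [RHS]eq_bigr => z _ do rewrite /c -sum1_card.
    rewrite (exchange_big_dep (mem A)) /=; last first.
      by move=> z k _; rewrite inE => /andP[].
    transitivity (\sum_(k in A) 2); first by rewrite sum_nat_const mulnC.
    apply: eq_bigr => k kA.
    have xk : x \in pblock (cls k) x by rewrite mem_pblock in_cover.
    have := cardsD1 x (pblock (cls k) x).
    rewrite xk (b3 k) ?pblock_mem ?in_cover // => -[->].
    by rewrite -sum1_card; apply: eq_bigl => z; rewrite !inE kA.
  by rewrite eqxx => /forallP/(_ y)/implyP; rewrite eq_sym => /(_ xy)/eqP.
have uniqk x y k k' b b' : x != y -> k \in A -> k' \in A -> b \in cls k ->
    b' \in cls k' -> x \in b -> y \in b -> x \in b' -> y \in b' ->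
    k = k' /\ b = b'.
  move=> xy kA kA' bk bk' xb yb xb' yb'.
  have /eqP/cards1P[k0 E] := mult1 _ _ xy.
  have /set1P Ek : k \in [set k0] by rewrite -E inE kA (pblE k b).
  have /set1P Ek' : k' \in [set k0] by rewrite -E inE kA' (pblE k' b').
  have eqk : k = k' by rewrite Ek.
  by split=> //; rewrite -(pblE k b x) // eqk (pblE k' b' x).
have two k b : k \in A -> b \in cls k -> exists x y, [/\ x \in b, y \in b & x != y].
  by move=> kA bk; apply/card_gt1P; rewrite (b3 k).
split; first split.
- by move=> b /bigcupP[k kA bk]; rewrite subsetT (b3 k).
- move=> x y _ _ xy; have [k [b [kA bk xb yb]]] := cov _ _ xy.
  exists b; split; first by split=> //; apply/bigcupP; exists k.
  move=> b' [/bigcupP[k' kA' bk'] [xb' yb']].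
  by have [] := uniqk x y k k' b b'.
- apply: partition_intro => [D|b|D D' b].
  + case/imsetP=> k kA ->; split; last exact: bigcup_sup.
    have /card_gt0P[x _] := P0.
    by apply/set0Pn; exists (pblock (cls k) x); rewrite pblock_mem ?in_cover.
  + by case/bigcupP=> k kA bk; exists (cls k) => //; apply: imset_f.
  + case/imsetP=> k kA -> /imsetP[k' kA' ->] bk bk'.
    have [x [y [xb yb xy]]] := two _ _ kA bk.
    by have [->] := uniqk x y k k' b b xy kA kA' bk bk' xb yb xb yb.
- by move=> D /imsetP[k kA ->]; apply: part.
Qed.

(** * Rainbow triples of a balanced colouring *)

(** Every ordered pair of distinct points is seen by exactly one block; irreflexivity removes the
    diagonal, which is seen by every block through the point. *)
Lemma sum_blocks (P : finType) (X : {set P}) (B : {set {set P}})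
    (F : rel P) :
  steiner_triple_system X B -> irreflexive F ->
  \sum_(b in B) \sum_(x in b) \sum_(y in b) F x y =
  \sum_(x in X) \sum_(y in X) F x y.
Proof.
move=> [tB uB] F0.
transitivity (\sum_(b in B) \sum_(x in X) \sum_(y in X)
                 ((x \in b) && (y \in b)) * F x y).
  apply: eq_bigr => b /tB[/subsetP bX _].
  rewrite [RHS](bigID (mem b)) /= [X in _ = _ + X]big1 ?addn0; last first.
    by move=> x /andP[_ /negbTE->]; rewrite big1.
  apply: eq_big => [x|x xb]; first by case xb: (x \in b); rewrite ?andbF ?bX.
  rewrite [RHS](bigID (mem b)) /= [X in _ = _ + X]big1 ?addn0; last first.
    by move=> y /andP[_ /negbTE->]; rewrite andbF.
  apply: eq_big => [y|y yb]; first by case yb: (y \in b); rewrite ?andbF ?bX.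
  by rewrite xb yb mul1n.
rewrite exchange_big; apply: eq_bigr => x xX.
rewrite exchange_big; apply: eq_bigr => y yX.
have [->|xy] := eqVneq x y; first by rewrite F0 big1 // => b _; rewrite muln0.
have [b [[bB [xb yb]] ub]] := uB _ _ xX yX xy.
rewrite (bigD1 b) //= xb yb mul1n big1 ?addn0 // => b' /andP[b'B b'b].
case xb': (x \in b'); case yb': (y \in b') => //.
by case/eqP: b'b; apply/esym/ub.
Qed.

(** Boolean form of [rainbow_triple], so that rainbow blocks form a finite set. *)
Definition rainbowb (P : finType) (phi : P -> 'I_3) (b : {set P}) :=
  [forall c, [exists x in b, phi x == c]].

Lemma rainbowP (P : finType) (phi : P -> 'I_3) (b : {set P}) :
  reflect (rainbow_triple phi b) (rainbowb phi b).
Proof.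
apply: (iffP forallP) => H c.
  by have /exists_inP[x xb /eqP] := H c; exists x.
by apply/exists_inP; have [x xb <-] := H c; exists x.
Qed.

(** In ordered pairs, a triple coloured 2 + 1 has 4 bichromatic and 2 monochromatic ones, and a
    rainbow triple has 6 and 0. *)
Lemma triple_colour_pairs (P : finType) (phi : P -> 'I_3) (b : {set P}) :
  #|b| = 3 -> ~ (exists c, forall x, x \in b -> phi x = c) ->
  \sum_(x in b) \sum_(y in b) (phi x != phi y) =
  2 * \sum_(x in b) \sum_(y in b) ((x != y) && (phi x == phi y)) +
  6 * rainbowb phi b.
Proof.
move=> b3; have [x [y [z [Eb xy xz yz]]]] : exists x y z,
    [/\ b = [set x; y; z], x != y, x != z & y != z].
  have /card_gt0P[z zb] : 0 < #|b| by rewrite b3.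
  have : #|b :\ z| == 2 by have := cardsD1 z b; rewrite zb b3; lia.
  case/cards2P=> x [y [xy E]]; exists x, y, z.
  have := setD11 z b; rewrite E !inE => /norP[zx zy].
  split; rewrite 1?[_ == z]eq_sym //.
  by rewrite -(setD1K zb) E setUC.
have sumE (F : P -> nat) : \sum_(u in b) F u = F x + F y + F z.
  rewrite Eb -setUA !big_setU1 ?inE ?negb_or ?xy ?xz //= big_set1 //; lia.
have rE : rainbowb phi b =
    [forall c, [|| phi x == c, phi y == c | phi z == c]].
  apply: eq_forallb => c; apply/exists_inP/or3P => [[u]|].
    by rewrite Eb !inE -orbA => /or3P[] /eqP-> ?; constructor.
  by case=> ?; [exists x|exists y|exists z]; rewrite // Eb !inE eqxx ?orbT.
move=> mono; have nmono : ~~ ((phi x == phi y) && (phi y == phi z)).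
  apply/negP => /andP[/eqP e1 /eqP e2]; apply: mono; exists (phi z) => u.
  by rewrite Eb !inE -orbA => /or3P[] /eqP->; rewrite ?e1 ?e2.
rewrite rE !sumE !eqxx (eq_sym y x) (eq_sym z x) (eq_sym z y).
rewrite (negbTE xy) (negbTE xz) (negbTE yz) /=.
rewrite (eq_sym (phi y) (phi x)) (eq_sym (phi z) (phi x)) (eq_sym (phi z) (phi y)).
move: nmono; move: (phi x) (phi y) (phi z).
(* The quantifier over colours becomes three tests, so that the 27 colourings of the triple can be
   settled by computation. *)
have all3 (Q : pred 'I_3) : [forall c, Q c] =
    [&& Q ord0, Q (inord 1) & Q (inord 2)].
  apply/forallP/and3P => [H|[q0 q1 q2] c]; first by split.
  suff [->|[->|->]] : c = ord0 \/ c = inord 1 \/ c = inord 2 by [].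
  by case: c => [[|[|[|]]] //] lt; [left|right;left|right;right];
    apply: val_inj; rewrite /= ?inordK.
by case=> [[|[|[|i]]] ?] [[|[|[|j]]] ?] [[|[|[|k]]] ?] //;
  rewrite all3 -!val_eqE /= ?inordK.
Qed.

(** For |X| = 3m there are 6m^2 bichromatic and 3m(m - 1) monochromatic ordered pairs. Summing
    [triple_colour_pairs] over the blocks leaves 6m for the rainbow ones, 6 for each. *)
Lemma card_rainbow_blocks (P : finType) (X : {set P}) (B : {set {set P}})
    (phi : P -> 'I_3) :
  steiner_triple_system X B -> three_colouring B phi ->
  (forall c, 3 * #|[set x in X | phi x == c]| = #|X|) ->
  3 * #|[set b in B | rainbowb phi b]| = #|X|.
Proof.
move=> sts col bal.
pose m := #|[set x in X | phi x == ord0]|.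
have mE c : #|[set x in X | phi x == c]| = m.
  by have := bal c; have := bal ord0; rewrite -/m; lia.
have Xm : #|X| = 3 * m by rewrite /m bal.
have cross : \sum_(x in X) \sum_(y in X) (phi x != phi y) = #|X| * (2 * m).
  rewrite -sum_nat_const; apply: eq_bigr => x xX.
  have := cardsID [set y in X | phi y == phi x] X.
  rewrite (setIidPr _) ?mE; last by apply/subsetP => y; rewrite inE => /andP[].
  rewrite Xm -big_mkcondr /= sum1_card => E.
  suff -> : #|[pred y in X | phi x != phi y]| =
     #|X :\: [set y in X | phi y == phi x]| by lia.
  by apply: eq_card => y; rewrite !inE eq_sym; case: (y \in X); rewrite ?andbF ?andbT.
have mono : \sum_(x in X) \sum_(y in X) ((x != y) && (phi x == phi y)) =
    #|X| * m.-1.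
  rewrite -sum_nat_const; apply: eq_bigr => x xX.
  rewrite -big_mkcondr /= sum1_card -(mE (phi x)) (cardsD1 x) inE xX eqxx /=.
  by apply: eq_card => y; rewrite !inE [y == x]eq_sym [phi y == _]eq_sym andbCA.
have irr1 : irreflexive (fun x y => phi x != phi y) by move=> x; rewrite /= eqxx.
have irr2 : irreflexive (fun x y => (x != y) && (phi x == phi y)).
  by move=> x; rewrite /= eqxx.
move: cross mono; rewrite -(sum_blocks sts irr1) -(sum_blocks sts irr2).
have tB := sts.1.
rewrite (eq_bigr _ (fun b bB => triple_colour_pairs (tB b bB).2 (col b bB))).
rewrite big_split /=.
have S6 : \sum_(b in B) 6 * rainbowb phi b =
    6 * #|[set b in B | rainbowb phi b]|.
  rewrite -big_distrr /= -big_mkcondr /= -sum1_card; congr (_ * _).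
  by apply: eq_bigl => b; rewrite inE.
rewrite S6 -big_distrr /= => cross mono; rewrite mono Xm in cross.
(* The case m = 0 is split off because [m.-1] is truncated. *)
have m0 : 3 * m * (2 * m) = 2 * (3 * m * m.-1) + 6 * m.
  by case: (m) => [|n] //=; rewrite mulnS !mulnA; lia.
by rewrite Xm; lia.
Qed.

(** A parallel class has |X|/3 triples, which is also the number of all rainbow triples, so the
    rainbow class exhausts them. *)
Lemma rainbow_blocks_class (P : finType) (X : {set P}) (B : {set {set P}})
    (R : {set {set {set P}}}) (phi : P -> 'I_3) :
  kirkman_triple_system X B R -> rainbow_colouring X B R phi ->
  [set b in B | rainbowb phi b] \in R.
Proof.
move=> [sts RB RX] [col bal [C CR rC]].
have sub : C \subset [set b in B | rainbowb phi b].
  apply/subsetP => b bC; rewrite inE (partition_sub RB CR bC).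
  exact/rainbowP/rC.
suff : C == [set b in B | rainbowb phi b] by move/eqP <-.
have cC : #|X| = #|C| * 3.
  apply: card_uniform_partition (RX _ CR) => b bC.
  by have [] := sts.1 b (partition_sub RB CR bC).
have cr := card_rainbow_blocks sts col bal.
by rewrite eqEcard sub; lia.
Qed.

(** * Transporting and gluing classes *)

(** Bundles the requirements on each class of the final system, so that they pass together through
    injections and disjoint unions. *)
Definition proper_class (P : finType) (phi : P -> 'I_3) (X : {set P})
    (D : {set {set P}}) : Prop :=
  partition D X /\ forall b, b \in D ->
    #|b| = 3 /\ ~ exists c, forall x, x \in b -> phi x = c.

Lemma proper_class_image (P Q : finType) (phi : P -> 'I_3) (phi' : Q -> 'I_3)
    (f : P -> Q) (X : {set P}) (D : {set {set P}}) :
  {in X &, injective f} -> {in X, forall x, phi' (f x) = phi x} ->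
  proper_class phi X D ->
  proper_class phi' (f @: X) [set f @: (b : {set P}) | b in D].
Proof.
move=> injf fcol [DX Dp]; have inX := partition_sub DX.
split.
  apply: partition_intro => [c /imsetP[b bD ->]|y /imsetP[x xX ->]|c c' y].
  - split; last exact/imsetS/(partitionS DX).
    by rewrite imset_eq0 (partition_neq0 DX).
  - by have [b bD xb] := partition_ex DX xX; exists (f @: b); rewrite imset_f.
  - case/imsetP=> b bD -> /imsetP[b' b'D ->] /imsetP[x xb ->] /imsetP[x' xb'].
    move/injf=> /(_ (inX _ _ bD xb) (inX _ _ b'D xb')) E; rewrite -E in xb'.
    by rewrite (partition_uniq DX bD b'D xb xb').
move=> c /imsetP[b bD ->]; have [b3 nm] := Dp _ bD; split.
  by rewrite card_in_imset // => x x' xb xb'; apply: injf; apply: (inX _ b).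
case=> k mono; apply: nm; exists k => x xb.
by rewrite -fcol ?(inX _ b) // mono // imset_f.
Qed.

Lemma proper_class_bigcup (P I : finType) (phi : P -> 'I_3) (A : {set I})
    (X : I -> {set P}) (D : I -> {set {set P}}) :
  (forall i, i \in A -> proper_class phi (X i) (D i)) ->
  (forall i j x, i \in A -> j \in A -> x \in X i -> x \in X j -> i = j) ->
  proper_class phi (\bigcup_(i in A) X i) (\bigcup_(i in A) D i).
Proof.
move=> DX disj; split; last first.
  by move=> b /bigcupP[i iA bD]; have [_] := DX _ iA; apply.
apply: partition_intro => [b /bigcupP[i iA bD]|x /bigcupP[i iA xX]|b b' x].
- have [part _] := DX _ iA; split; first exact: partition_neq0 part bD.
  exact: subset_trans (partitionS part bD) (bigcup_sup _ iA).
- have [part _] := DX _ iA; have [b bD xb] := partition_ex part xX.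
  by exists b => //; apply/bigcupP; exists i.
- case/bigcupP=> i iA bD /bigcupP[j jA bD'] xb xb'.
  have [[parti _] [partj _]] := (DX _ iA, DX _ jA).
  have E := disj _ _ _ iA jA (partition_sub parti bD xb)
    (partition_sub partj bD' xb').
  by rewrite -E in bD'; apply: (partition_uniq parti bD bD' xb xb').
Qed.

Lemma proper_classU (P : finType) (phi : P -> 'I_3) (X X' : {set P})
    (D D' : {set {set P}}) :
  proper_class phi X D -> proper_class phi X' D' -> [disjoint X & X'] ->
  proper_class phi (X :|: X') (D :|: D').
Proof.
move=> DX DX' /pred0P disj.
have setUE (T : finType) (A A' : {set T}) :
    A :|: A' = \bigcup_(i in [set: bool]) if i then A else A'.
  apply/setP => x; rewrite inE; apply/orP/bigcupP => [|[[] _ ?]].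
  - by case=> ?; [exists true|exists false].
  - by left.
  - by right.
rewrite !setUE; apply: proper_class_bigcup => [[] //|[] [] x _ _ //= xX xX'].
  by have := disj x; rewrite /= xX xX'.
by have := disj x; rewrite /= xX xX'.
Qed.

(** * Filling a tripled group together with the common points *)

Definition tripled (V W : finType) (g : {set V}) : {set V * 'I_3 + W} :=
  [set q | if q is inl p then p.1 \in g else false].

Definition base (V W : finType) : {set V * 'I_3 + W} :=
  [set q | if q is inr _ then true else false].

Definition level (V W : finType) (psi : W -> 'I_3) (q : V * 'I_3 + W) : 'I_3 :=
  match q with inl p => p.2 | inr z => psi z end.

Lemma card_tripled_level (V W : finType) (psi : W -> 'I_3) (g : {set V}) c :
  #|[set q in tripled W g | level psi q == c]| = #|g|.
Proof.
rewrite -(card_imset (mem g) (f := fun x => inl (x, c) : V * 'I_3 + W)).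
  2: by move=> x y [].
apply: eq_card => q; rewrite !inE; apply/andP/imsetP.
  by case: q => [[x i]|z] [] //= xg /eqP <-; exists x.
by case=> x xg ->; rewrite /= eqxx.
Qed.

Lemma card_base_level (V W : finType) (psi : W -> 'I_3) c :
  #|[set q in base V W | level psi q == c]| = #|[set z | psi z == c]|.
Proof.
rewrite -(card_imset (mem [set z | psi z == c])
            (f := fun z => inr z : V * 'I_3 + W)).
  2: by move=> x y [].
apply: eq_card => q; rewrite !inE; apply/andP/imsetP.
  by case: q => [[x i]|z] [] //= _ pz; exists z; rewrite ?inE.
by case=> z; rewrite inE => pz ->.
Qed.

(** Fibre sizes for the colouring that marks one element, as input to [colour_matching]. *)
Lemma card_marked (T : finType) (A : {set T}) x c :
  x \in A -> #|[set y in A | (y == x) == c]| = if c then 1 else #|A|.-1.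
Proof.
move=> xA; case: c.
  rewrite -(cards1 x); apply: eq_card => y; rewrite !inE eqb_id.
  by case: eqVneq => [->|]; rewrite ?xA ?andbF.
rewrite (cardsD1 x A) xA /=; apply: eq_card => y.
by rewrite !inE eqbF_neg andbC.
Qed.

(** [N] lists the classes of the filling that extend no class of its subsystem, and [H] the
    remainders of those that do. Pairs inside the base are left to the single system placed on
    [W]. *)
Lemma fill_group (V W KW J : finType) (psi : W -> 'I_3) (AW : {set KW}) k0
    (AJ : {set J}) (g : {set V}) (P : finType) (B : {set {set P}})
    (R : {set {set {set P}}}) (phi : P -> 'I_3) :
  0 < #|W| -> #|W| = (2 * #|AW|).+1 -> k0 \in AW ->
  (forall c, 3 * #|[set z | psi z == c]| = #|W|) ->
  2 * #|AJ| = 3 * #|g| -> #|P| = 3 * #|g| + #|W| ->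
  kirkman_triple_system [set: P] B R -> rainbow_colouring [set: P] B R phi ->
  has_rainbow_subsystem [set: P] B R phi #|W| ->
  exists N : J -> {set {set V * 'I_3 + W}},
  exists H : KW -> {set {set V * 'I_3 + W}},
  [/\ forall j, j \in AJ ->
        proper_class (level psi) (tripled W g :|: base V W) (N j),
      forall k, k \in AW -> proper_class (level psi) (tripled W g) (H k),
      forall b, b \in H k0 -> rainbow_triple (level psi) b
    & forall p q, p \in tripled W g -> q \in tripled W g :|: base V W ->
        p != q -> exists b : {set V * 'I_3 + W}, [/\ p \in b, q \in b &
          (exists2 j, j \in AJ & b \in N j) \/
          (exists2 k, k \in AW & b \in H k)]].
Proof.
move=> W0 WAW k0A balW cJ cP kts rbw [X' [B' [R' [[kts' _ sB' ext] cX' rbw']]]].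
have [sts RB RX] := kts; have [sts' RB' RX'] := kts'.
have [col bal _] := rbw; have [col' bal' _] := rbw'.
have CR := rainbow_blocks_class kts rbw.
have CR' := rainbow_blocks_class kts' rbw'.
set C := [set b in B | _] in CR; set C' := [set b in B' | _] in CR'.
(* Made total, with a dummy value off [R'], so that a choice function [e] of extending classes can
   be extracted. *)
have {}ext D' : exists D, D' \in R' -> D \in R /\ D' \subset D.
  by case: (boolP (D' \in R')) => [/ext[D ? ?]|_]; [exists D|exists set0].
have [e eP] := fin_all_exists ext.
have X'0 : 0 < #|X'| by rewrite cX'.
have C'C : C' \subset C.
  by apply/subsetP => b; rewrite !inE => /andP[/(subsetP sB')-> ->].
(* The extension of [C'] shares a block with [C], because rainbow triples of the subsystem are
   rainbow in the whole system. *)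
have eC' : e C' = C.
  have [eR sub] := eP _ CR'.
  have /set0Pn[b bC'] := partition_neq0 RB' CR'.
  exact: partition_uniq RB eR CR (subsetP sub _ bC') (subsetP C'C _ bC').
(* Classes with a common extension have the same block through a point of [X'], hence coincide. *)
have inje : {in R' &, injective e}.
  move=> D D' DR DR' E; have [eR sub] := eP _ DR; have [_ sub'] := eP _ DR'.
  have /card_gt0P[x xX'] := X'0.
  have [b bD xb] := partition_ex (RX' _ DR) xX'.
  have [b' bD' xb'] := partition_ex (RX' _ DR') xX'.
  have Eb : b = b'.
    apply: (partition_uniq (RX _ eR) _ _ xb xb'); first exact: (subsetP sub).
    by rewrite E; apply: (subsetP sub').
  by apply: (partition_uniq RB' DR DR' bD); rewrite Eb.
have cR' : #|W| = (2 * #|R'|).+1 by rewrite -cX'; apply: card_KTS_classes kts' _.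
have cR : #|P| = (2 * #|R|).+1.
  by rewrite -cardsT; apply: card_KTS_classes kts _; rewrite cardsT cP; lia.
have eRR : e @: R' \subset R by apply/subsetP => D /imsetP[D' /eP[? _] ->].
(* Marking [k0] and [C'] makes the indexing of subsystem classes send [k0] to the rainbow one. *)
have [h [injh hR' hC]] : exists h : KW -> {set {set P}},
    [/\ {in AW &, injective h}, h @: AW = R'
      & {in AW, forall k, (h k == C') = (k == k0)}].
  apply: (colour_matching (col := fun k => k == k0) (col' := fun D => D == C')).
    exact: set0.
  have cAW : #|AW| = #|R'| by lia.
  by move=> c; rewrite !card_marked // cAW.
(* The number of remaining classes is |R| - |R'| = (|P| - |W|)/2 = 3|g|/2 = |AJ|. *)
have [n [injn nR _]] : exists n : J -> {set {set P}},
    [/\ {in AJ &, injective n}, n @: AJ = R :\: e @: R'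
      & {in AJ, forall j, tt = tt}].
  apply: (colour_matching (col := fun=> tt) (col' := fun=> tt)); first exact: set0.
  have allE (T : finType) (A : {set T}) c : [set x in A | tt == c] = A.
    by apply/setP => x; rewrite inE; case: c; rewrite andbT.
  move=> c; rewrite !allE.
  have := cardsID (e @: R') R; rewrite (setIidPr eRR) card_in_imset // => cD.
  have arith j r r' s p w t : 2 * j = 3 * t -> p = 3 * t + w ->
      p = (2 * r).+1 -> w = (2 * r').+1 -> r' + s = r -> j = s by lia.
  exact: arith cJ cP cR cR' cD.
have hk0 : h k0 = C' by apply/eqP; rewrite hC.
have /card_gt0P[z0 _] := W0.
(* Membership in the subsystem is made part of the colour, so the bijection preserves colours and
   also carries [X'] onto the base. *)
have [f [injf fT fcol]] : exists f : P -> V * 'I_3 + W,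
    [/\ {in [set: P] &, injective f}, f @: [set: P] = tripled W g :|: base V W
      & {in [set: P], forall x, (level psi (f x), f x \in base V W) =
                                (phi x, x \in X')}].
  apply: (colour_matching (col := fun x => (phi x, x \in X'))
    (col' := fun q => (level psi q, q \in base V W))); first exact: inr z0.
  have cX'c c : #|[set x in X' | phi x == c]| = #|[set z | psi z == c]|.
    by have := bal' c; have := balW c; lia.
  case=> c []; last first.
    have -> : [set y in tripled W g :|: base V W |
        (level psi y, y \in base V W) == (c, false)] =
        [set q in tripled W g | level psi q == c].
      by apply/setP => -[[x i]|z]; rewrite !inE xpair_eqE /= ?andbT ?orbF ?andbF.
    rewrite card_tripled_level.
    have := cardsID X' [set x | phi x == c].
    have -> : [set x | phi x == c] :&: X' = [set x in X' | phi x == c].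
      by apply/setP => x; rewrite !inE andbC.
    have -> : [set x in [set: P] | (phi x, x \in X') == (c, false)] =
       [set x | phi x == c] :\: X'.
      by apply/setP => x; rewrite !inE /= xpair_eqE eqbF_neg andbC.
    rewrite cX'c; have := balW c; have := bal c; rewrite cardsT.
    have -> : [set x in [set: P] | phi x == c] = [set x | phi x == c].
      by apply/setP => x; rewrite !inE.
    lia.
  have -> : [set y in tripled W g :|: base V W |
        (level psi y, y \in base V W) == (c, true)] =
        [set q in base V W | level psi q == c].
    by apply/setP => -[[x i]|z]; rewrite !inE xpair_eqE /= ?andbT ?orbF ?andbF.
  rewrite card_base_level -cX'c; apply: eq_card => x.
  by rewrite !inE /= xpair_eqE eqb_id andbC.
have {}injf : injective f by move=> x y; apply: injf; rewrite inE.
have fbase x : (f x \in base V W) = (x \in X') by have [] := fcol _ (in_setT x).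
have flev x : level psi (f x) = phi x by have [] := fcol _ (in_setT x).
have fX' : f @: (~: X') = tripled W g.
  apply/setP => q; apply/imsetP/idP => [[x]|qg].
    rewrite inE -fbase => nb ->; have : f x \in f @: setT by rewrite imset_f.
    by rewrite fT inE (negbTE nb) orbF.
  have : q \in f @: setT by rewrite fT inE qg.
  case/imsetP=> x _ E; exists x => //; rewrite inE -fbase -E.
  by move: qg; rewrite !inE; case: q {E}.
have propR D : D \in R -> proper_class phi setT D.
  move=> DR; split; first exact: RX.
  move=> b bD; have bB := partition_sub RB DR bD.
  by split; [have [] := sts.1 b bB|apply: col].
pose img (D : {set {set P}}) := [set f @: (b : {set P}) | b in D].
have hR k : k \in AW -> h k \in R' by move=> kA; rewrite -hR' imset_f.
exists (fun j => img (n j)), (fun k => img (e (h k) :\: h k)).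
split.
- move=> j jA; rewrite -fT; apply: (proper_class_image (phi := phi)).
  + by move=> x y _ _; apply: injf.
  + by move=> x _; apply: flev.
  + have : n j \in n @: AJ by apply: imset_f.
    by rewrite nR inE => /andP[_]; apply: propR.
- move=> k /hR kR; have [eR sub] := eP _ kR.
  rewrite -fX'; apply: (proper_class_image (phi := phi)).
  + by move=> x y _ _; apply: injf.
  + by move=> x _; apply: flev.
  + have [part prop] := propR _ eR; split; last first.
      by move=> b; rewrite inE => /andP[_]; apply: prop.
    apply: partition_intro => [b|x|b b' x].
    (* A remaining block avoids [X']: the points of [X'] are already covered by the blocks of [h k],
       which lie in the same class. *)
    * rewrite inE => /andP[bh be]; split; first exact: partition_neq0 part be.
      apply/subsetP => x xb; rewrite inE; apply: contra bh => xX'.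
      have [b' b'h xb'] := partition_ex (RX' _ kR) xX'.
      by rewrite (partition_uniq part be (subsetP sub _ b'h) xb xb').
    * rewrite inE => xX'; have [b be xb] := partition_ex part (in_setT x).
      exists b => //; rewrite inE be andbT; apply: contra xX' => bh.
      exact: partition_sub (RX' _ kR) bh xb.
    * rewrite !inE => /andP[_ be] /andP[_ be']; exact: partition_uniq part be be'.
- move=> d; rewrite hk0 eC' => /imsetP[b].
  rewrite !inE => /andP[_ /andP[_ /rainbowP rb]] -> c.
  by have [x xb <-] := rb c; exists (f x); [apply: imset_f|apply: flev].
- move=> p q; rewrite -fT -fX' => /imsetP[x xX' ->] /imsetP[y _ ->].
  rewrite (inj_eq injf) => xy.
  have [b [[bB [xb yb]] _]] := sts.2 x y (in_setT _) (in_setT _) xy.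
  exists (f @: b); split; rewrite ?imset_f //.
  have [D DR bD] := partition_ex RB bB.
  case: (boolP (D \in e @: R')) => De.
    right; case/imsetP: De => D'; rewrite -hR' => /imsetP[k kA ->] E.
    exists k => //; apply/imset_f; rewrite inE -E bD andbT.
    apply: contraL xX' => bh; rewrite inE negbK.
    exact: partition_sub (RX' _ (hR _ kA)) bh xb.
  left; have : D \in n @: AJ by rewrite nR inE De.
  by case/imsetP=> j jA E; exists j => //; apply/imset_f; rewrite -E.
Qed.

(** * Lifting frame blocks to three levels *)

Definition lift_block (V W : finType) (b : {set V}) (z : V) (i : 'I_3) :
    {set V * 'I_3 + W} :=
  [set inl (y, if y == z then ordS i else i) | y in b].

(* The parallel class is selected by the position [d] of the raised point [z] in
   [enum b]; the default [z0] is never reached on triples. *)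
Definition lift_class (V W : finType) (z0 : V) (F : {set {set V}}) (d : 'I_3) :
    {set {set V * 'I_3 + W}} :=
  [set lift_block W b (nth z0 (enum b) d) i | b in F, i in [set: 'I_3]].

Lemma ordS_neq (i : 'I_3) : ordS i != i.
Proof. by case: i => [[|[|[|]]]]. Qed.

Lemma ordS3_cases (i j : 'I_3) : [\/ i = j, j = ordS i | i = ordS j].
Proof.
by case: i j => [[|[|[|i]]] // ?] [[|[|[|j]]] // ?];
  [constructor 1|constructor 2|constructor 3|constructor 3|constructor 1
  |constructor 2|constructor 2|constructor 3|constructor 1]; apply: val_inj.
Qed.

Lemma mem_lift_block (V W : finType) (b : {set V}) z i x j :
  (inl (x, j) \in lift_block W b z i) =
  (x \in b) && (j == if x == z then ordS i else i).
Proof.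
apply/imsetP/andP => [[y yb [-> ->]]|[xb /eqP->]]; first by [].
by exists x.
Qed.

(** Over a fixed block [b] with fixed raised point, each point of [b] meets every level once as [i]
    varies, so the three lifts partition b x Z_3. *)
Lemma lift_class_proper (V W : finType) (psi : W -> 'I_3) (z0 : V) (X : {set V})
    (F : {set {set V}}) (d : 'I_3) :
  partition F X -> (forall b, b \in F -> #|b| = 3) ->
  proper_class (level psi) (tripled W X) (lift_class W z0 F d).
Proof.
move=> FX b3.
have zb b : b \in F -> nth z0 (enum b) d \in b.
  by move=> bF; rewrite -mem_enum mem_nth // -cardE b3.
split; last first.
  move=> c /imset2P[b i bF _ ->]; split.
    by rewrite card_in_imset ?b3 // => x y _ _ [].
  case=> k mono; set z := nth z0 (enum b) d in mono.
  have /card_gt0P[y] : 0 < #|b :\ z|.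
    by have := cardsD1 z b; rewrite zb // b3 //; lia.
  rewrite !inE => /andP[yz yb].
  have := mono (inl (y, i)).
  rewrite mem_lift_block yb (negbTE yz) eqxx => /(_ isT) /= e1.
  have := mono (inl (z, ordS i)).
  rewrite mem_lift_block zb // !eqxx => /(_ isT) /= e2.
  by have := ordS_neq i; rewrite e2 e1 eqxx.
apply: partition_intro => [c|[[x j]|z]|c c' [[x j]|z]].
- case/imset2P=> b i bF _ ->; split.
    by rewrite imset_eq0 (partition_neq0 FX).
  by apply/subsetP => p /imsetP[y yb ->]; rewrite inE; apply: partition_sub FX bF yb.
- rewrite inE => xX; have [b bF xb] := partition_ex FX xX.
  pose z := nth z0 (enum b) d.
  (* If [x] is itself the raised point, the block must start one level below [j]. *)
  exists (lift_block W b z (if x == z then ord_pred j else j)).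
    by apply/imset2P; exists b (if x == z then ord_pred j else j).
  by rewrite mem_lift_block xb; case: (x == z); rewrite ?ord_predK eqxx.
- by rewrite inE.
- case/imset2P=> b i bF _ -> /imset2P[b' i' bF' _ ->].
  rewrite !mem_lift_block => /andP[xb /eqP->] /andP[xb'].
  rewrite -(partition_uniq FX bF bF' xb xb').
  by case: ifP => _ /eqP; [move/ordS_inj|] => ->.
- by case/imset2P=> b i _ _ -> /imset2P[b' i' _ _ ->] /imsetP[].
Qed.

(** Two levels of Z_3 differ by 0, 1 or -1. If they are equal the third point of [b] is raised,
    otherwise whichever of [x] and [y] is one level above the other. *)
Lemma lift_class_cover (V W : finType) (z0 x y : V) (F : {set {set V}})
    (b : {set V}) i j :
  b \in F -> #|b| = 3 -> x \in b -> y \in b -> x != y ->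
  exists d c, [/\ c \in lift_class W z0 F d, inl (x, i) \in c & inl (y, j) \in c].
Proof.
move=> bF b3 xb yb xy.
have lvl z k : z \in b -> exists d, lift_block W b z k \in lift_class W z0 F d.
  move=> zb; have lt : index z (enum b) < 3.
    by rewrite -b3 cardE index_mem mem_enum.
  exists (Ordinal lt); apply/imset2P; exists b k; rewrite ?inE //=.
  by rewrite nth_index ?mem_enum.
have yx : (y == x) = false by rewrite eq_sym (negbTE xy).
case: (ordS3_cases i j) => [->|->|->].
- have /card_gt0P[z] : 0 < #|b :\ x :\ y|.
    have := cardsD1 x b; have := cardsD1 y (b :\ x).
    by rewrite xb b3 !inE yb yx /=; lia.
  rewrite !inE => /and3P[zy zx zb]; have [d bd] := lvl z j zb.
  exists d, (lift_block W b z j); rewrite !mem_lift_block xb yb.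
  by rewrite ![_ == z]eq_sym (negbTE zy) (negbTE zx) eqxx.
- have [d bd] := lvl y i yb; exists d, (lift_block W b y i).
  by rewrite !mem_lift_block xb yb (negbTE xy) !eqxx.
- have [d bd] := lvl x j xb; exists d, (lift_block W b x j).
  by rewrite !mem_lift_block xb yb yx !eqxx.
Qed.

(** * Assembling the rainbow Kirkman triple system *)

Unset Implicit Arguments.

Theorem theorem3p4 (v w : nat) (T : seq nat) (hv : 0 < v) (hw : 0 < w)
    (hframe : exists (V : finType) (G B : {set {set V}})
                (R : {set {set {set V}}}),
        [/\ #|V| = v, kirkman_frame [set: V] G B R
          & perm_eq (group_type G) T])
    (hfill : forall t, t \in T ->
        exists (P : finType) (B : {set {set P}}) (R : {set {set {set P}}})
               (phi : P -> 'I_3),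
        [/\ #|P| = 3 * t + w,
            kirkman_triple_system [set: P] B R,
            rainbow_colouring [set: P] B R phi
          & has_rainbow_subsystem [set: P] B R phi w]) :
  exists (P : finType) (B : {set {set P}}) (R : {set {set {set P}}}),
    [/\ #|P| = 3 * v + w,
        kirkman_triple_system [set: P] B R
      & exists phi : P -> 'I_3, rainbow_colouring [set: P] B R phi].
Proof.
case: hframe => V [G [B [R [cV frame typeT]]]].
have {}hfill g : g \in G -> exists (P : finType) (B : {set {set P}})
    (R : {set {set {set P}}}) (phi : P -> 'I_3),
    [/\ #|P| = 3 * #|g| + w, kirkman_triple_system [set: P] B R,
        rainbow_colouring [set: P] B R phi
      & has_rainbow_subsystem [set: P] B R phi w].
  move=> gG; apply: hfill; rewrite -(perm_mem typeT).
  by apply/mapP; exists g; rewrite ?mem_enum.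
have [[GV tB uB _] RB RG] := frame.
have /card_gt0P[z0 _] : 0 < #|V| by rewrite cV.
have [g0 g0G z0g0] := partition_ex GV (in_setT z0).
(* With a single group, that group is all of [V] and its filling is already the required system. The
   frame class counts are for at least two groups. *)
have [G1|] := ltnP 1 #|G|; last first.
  move=> cG; have [P [BP [RP [phi [cP kP rP _]]]]] := hfill _ g0G.
  have /eqP EG : G == [set g0] by rewrite eq_sym eqEcard sub1set g0G cards1.
  have Eg0 : g0 = setT.
    by rewrite -(cover_partition GV) EG /cover big_set1.
  exists P, BP, RP; split=> //; last by exists phi.
  by rewrite cP Eg0 cardsT cV.
have [cR cRg] := card_frame_classes frame G1.
(* A subsystem from one filling of [g0] supplies the common system on [W]. *)
have [P0 [B0 [R0 [phi [cP0 kP0 rP0 [X' [B' [R' [[kts' _ _ _] cX' rbw']]]]]]]]] :=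
  hfill _ g0G.
have [sts' RB' RX'] := kts'; have [col' bal' [C' CR' rC']] := rbw'.
pose W : finType := {x : P0 | x \in X'}.
pose psi (z : W) := phi (val z).
have cW : #|W| = w by rewrite card_sig.
have W0 : 0 < #|W| by rewrite cW.
have /card_gt0P[w0 _] := W0.
have cR' : #|W| = (2 * #|R'|).+1.
  by rewrite cW -cX'; apply: (card_KTS_classes kts'); rewrite cX'.
have balW c : 3 * #|[set z | psi z == c]| = #|W|.
  rewrite cW -cX' -(bal' c); congr (3 * _).
  rewrite -(card_imset _ val_inj); apply: eq_card => x; rewrite inE.
  apply/imsetP/andP => [[z]|[xX pc]]; first by rewrite inE => pz ->; rewrite (valP z).
  by exists (exist _ x xX); rewrite ?inE.
(* Each frame class missing [g] lifts to three classes, which together miss exactly the points above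
   [g] and the base; there are 3|g|/2 such lifts, one for each [N j]. *)
pose AJ (g : {set V}) := setX [set F in R | partition F (~: g)] [set: 'I_3].
pose Q : finType := (V * 'I_3 + W)%type.
have fillG (g : {set V}) : exists NH : ({set {set V}} * 'I_3 -> {set {set Q}}) *
    ({set {set P0}} -> {set {set Q}}), g \in G ->
  [/\ forall j, j \in AJ g ->
        proper_class (level psi) (tripled W g :|: base V W) (NH.1 j),
      forall k, k \in R' -> proper_class (level psi) (tripled W g) (NH.2 k),
      forall b, b \in NH.2 C' -> rainbow_triple (level psi) b
    & forall p q, p \in tripled W g -> q \in tripled W g :|: base V W ->
        p != q -> exists b : {set V * 'I_3 + W}, [/\ p \in b, q \in b &
          (exists2 j, j \in AJ g & b \in NH.1 j) \/
          (exists2 k, k \in R' & b \in NH.2 k)]].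
  case: (boolP (g \in G)) => gG; last by exists (fun=> set0, fun=> set0).
  have [P [BP [RP [phP [cP kP rP sP]]]]] := hfill _ gG.
  rewrite -cW in cP sP.
  have cJ : 2 * #|AJ g| = 3 * #|g|.
    by rewrite -cRg // cardsX cardsT card_ord; lia.
  have [N [H NHP]] := fill_group W0 cR' CR' balW cJ cP kP rP sP.
  by exists (N, H).
have [NH NHP] := fin_all_exists fillG.
have holes (F : {set {set V}}) :
    exists g, F \in R -> g \in G /\ partition F (~: g).
  case: (boolP (F \in R)) => [/RG[g gG]|_]; last by exists set0.
  by rewrite setTD => Fg; exists g.
have [hole holeP] := fin_all_exists holes.
pose K : finType := ({set {set P0}} + {set {set V}} * 'I_3)%type.
pose A : {set K} := inl @: R' :|: inr @: setX R [set: 'I_3].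
(* Carries [X'] onto the base; the default [w0] is reached only outside [X']. *)
pose f x : Q := inr (insubd w0 x).
(* There are two kinds of classes: a class on [W] completed by one remainder above every group, and
   a lifted frame class completed by a full class on its hole and the base. *)
pose cls (k : K) : {set {set Q}} := match k with
  | inl D => [set f @: (b : {set P0}) | b in D] :|: \bigcup_(g in G) (NH g).2 D
  | inr p => (NH (hole p.1)).1 p :|: lift_class W z0 p.1 p.2 end.
have inA k : (k \in A) = match k with inl D => D \in R' | inr p => p.1 \in R end.
  rewrite inE; apply/orP/idP => [[] /imsetP[D DR ->] //|].
    by move: DR; rewrite inE => /andP[].
  by case: k => [D|[F d]] kR; [left|right]; apply/imsetP;
    [exists D|exists (F, d); rewrite ?inE ?andbT].
have cA : #|A| = #|R'| + 3 * #|R|.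
  rewrite cardsU (_ : _ :&: _ = set0) ?cards0 ?subn0.
    rewrite !card_imset; [|by move=> ? ? []|by move=> ? ? []].
    by rewrite cardsX cardsT card_ord mulnC.
  apply/setP => k; rewrite !inE; apply/negP => /andP[/imsetP[D _ ->]].
  by case/imsetP.
have cQ : #|Q| = 3 * v + w.
  by rewrite card_sum card_prod card_ord cV cW mulnC.
have injf : {in X' &, injective f}.
  by move=> x y xX yX [] /(congr1 val); rewrite !val_insubd xX yX.
have fX' : f @: X' = base V W.
  apply/setP => q; rewrite inE; apply/imsetP/idP => [[x _ ->] //|].
  case: q => // z _; exists (val z); first exact: valP.
  by rewrite /f valKd.
have propW D : D \in R' -> proper_class (level psi) (base V W)
    [set f @: (b : {set P0}) | b in D].
  move=> DR; rewrite -fX'; apply: (proper_class_image (phi := phi)) => //.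
    by move=> x xX; rewrite /= /psi val_insubd xX.
  split; first exact: RX'.
  move=> b bD; have bB := partition_sub RB' DR bD.
  by split; [have [] := sts'.1 b bB|apply: col'].
have grp x : exists2 g, g \in G & x \in g := partition_ex GV (in_setT x).
have propcls k : k \in A -> proper_class (level psi) setT (cls k).
  rewrite inA; case: k => [D DR|[F d] /= FR].
    have -> : [set: Q] = base V W :|: \bigcup_(g in G) tripled W g.
      apply/setP => -[[x i]|z]; rewrite !inE //=.
      by have [g gG xg] := grp x; apply/esym/bigcupP; exists g; rewrite ?inE.
    apply: proper_classU; first exact: propW.
      apply: proper_class_bigcup => [g gG|g h [[x i]|z] gG hG].
      - by have [_ + _ _] := NHP _ gG; apply.
      - by rewrite !inE; apply: partition_uniq GV gG hG.
      - by rewrite inE.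
    apply/pred0P => -[[x i]|z]; rewrite /= !inE //.
    by apply/negP => /bigcupP[g _]; rewrite inE.
  have [gG Fg] := holeP _ FR.
  have -> : [set: Q] = (tripled W (hole F) :|: base V W) :|: tripled W (~: hole F).
    by apply/setP => -[[x i]|z]; rewrite !inE //= ?inE; case: (x \in _).
  apply: proper_classU.
  - by have [+ _ _ _] := NHP _ gG; apply; rewrite !inE FR Fg.
  - apply: lift_class_proper => // b bF.
    by have [] := tB b (partition_sub RB FR bF).
  - by apply/pred0P => -[[x i]|z]; rewrite /= !inE //= ?inE; case: (x \in _).
have cover_fill g (p q : Q) : g \in G -> p \in tripled W g ->
    q \in tripled W g :|: base V W -> p != q ->
    exists k b, [/\ k \in A, b \in cls k, p \in b & q \in b].
  move=> gG pg qg pq; have [_ _ _ /(_ p q pg qg pq)] := NHP _ gG.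
  case=> b [pb qb [[[F d]]|[D DR bD]]].
    rewrite !inE /= andbT => /andP[FR Fg] bN.
    exists (inr (F, d)), b; rewrite inA; split=> //.
    rewrite inE /=; have [_ Fh] := holeP _ FR.
    (* A frame class determines its hole, as the complement of its union. *)
    have -> : hole F = g; last by rewrite bN.
    apply: setC_inj; by rewrite -(cover_partition Fg) -(cover_partition Fh).
  exists (inl D), b; rewrite inA; split=> //.
  by rewrite inE; apply/orP; right; apply/bigcupP; exists g.
have coverP (p q : Q) : p != q ->
    exists k b, [/\ k \in A, b \in cls k, p \in b & q \in b].
  (* Pairs in different groups come from lifted frame blocks, pairs inside [W] from the common
     system, and all others from the filling of a group. *)
  case: p q => [[x i]|z] [[y j]|z'] pq.
  - have [[g gG xg] [h hG yh]] := (grp x, grp y).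
    have [Egh|gh] := eqVneq g h.
      by apply: (cover_fill g) => //; rewrite !inE //= Egh yh.
    have [b [[bB [xb yb]] _]] := uB g h x y gG hG gh xg yh.
    have [F FR bF] := partition_ex RB bB.
    have xy : x != y.
      by apply: contra_neq gh => E; apply: (partition_uniq GV gG hG xg); rewrite E.
    have [d [c [cF xc yc]]] := lift_class_cover W z0 i j bF (tB b bB).2 xb yb xy.
    by exists (inr (F, d)), c; rewrite inA; split=> //; rewrite inE cF orbT.
  - have [g gG xg] := grp x.
    by apply: (cover_fill g) => //; rewrite !inE.
  - have [g gG xg] := grp y.
    have [|||k [b [? ? ? ?]]] := cover_fill g (inl (y, j)) (inr z) gG; rewrite ?inE //.
    by exists k, b.
  - have zz : val z != val z'.
      by rewrite (inj_eq val_inj); apply: contra pq => /eqP->.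
    have [b [[bB [zb zb']] _]] := sts'.2 _ _ (valP z) (valP z') zz.
    have [D DR bD] := partition_ex RB' bB.
    have fK y : inr y = f (val y) by rewrite /f valKd.
    exists (inl D), (f @: b); rewrite inA; split=> //; rewrite ?fK ?imset_f //.
    by rewrite inE imset_f.
(* The number of classes is |R'| + 3|R| = (w - 1)/2 + 3v/2, which is half of 3v + w - 1. *)
have ktsQ : kirkman_triple_system [set: Q] (\bigcup_(k in A) cls k) (cls @: A).
  apply: KTS_of_classes => //.
  - by rewrite cQ; lia.
  - by rewrite cQ cA; lia.
  - by move=> k /propcls[].
  - by move=> k b /propcls[_ prop] /prop[].
exists Q, (\bigcup_(k in A) cls k), (cls @: A); split=> //.
exists (level psi); split.
- by move=> b /bigcupP[k /propcls[_ prop] /prop[]].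
- move=> c; rewrite cardsT.
  (* Each colour occurs v times above the frame and w/3 times on [W]. *)
  have := cardsID (base V W) [set q : Q | level psi q == c].
  have -> : [set q : Q | level psi q == c] :&: base V W =
            [set q in base V W | level psi q == c].
    by apply/setP => q; rewrite !inE andbC.
  have -> : [set q : Q | level psi q == c] :\: base V W =
            [set q in tripled W [set: V] | level psi q == c].
    by apply/setP => -[[x i]|z]; rewrite !inE.
  rewrite card_base_level card_tripled_level cardsT cV cQ.
  have -> : [set x in [set: Q] | level psi x == c] = [set q : Q | level psi q == c].
    by apply/setP => q; rewrite !inE.
  by rewrite -cW -(balW c) -mulnDr addnC => ->.
(* The index [C'] plays the role of [k0] in every filling, so all remainders glued here are
   rainbow. *)
- exists (cls (inl C')); first by apply: imset_f; rewrite inA.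
  move=> b; rewrite inE => /orP[/imsetP[d dC ->]|/bigcupP[g gG bH]]; last first.
    by have [_ _ + _] := NHP _ gG; apply.
  move=> c; have [x xd <-] := rC' _ dC c; exists (f x); first exact: imset_f.
  have xX : x \in X' by apply: partition_sub (RX' _ CR') dC xd.
  by rewrite /= /psi val_insubd xX.
Qed.
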